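(* Let $d\ge 3$ be an odd integer. For all integers $k\ge 1$, $$\psi_k\big(\mathrm{Rist}_{G_d}(\widehat{k})\big)=\underbrace{H_k\times\cdots\times H_k}_{d^k\text{ copies}},$$ where $H_k=\{w\in G_d : |w|_A\equiv 0 \pmod{2^{k+1}}\}$.
   Context: Let $d\ge 3$ be odd and $X=\{1,\dots,d\}$. Let $T$ be the $d$-regular rooted tree whose vertex set is the set $X^*$ of finite words over $X$, with root the empty word, the children of $u$ being $ux$, $x\in X$; $X^k$ is the $k$-th level. $\mathrm{Aut}(T)$ is the group of root-preserving graph automorphisms of $T$, with product $gh(u)=h(g(u))$ and identity $e$. For $g\in\mathrm{Aut}(T)$ and $u\in X^*$, the section $g|_u\in\mathrm{Aut}(T)$ is determined by $g(uv)=g(u)\,g|_u(v)$ for all $v\in X^*$. The wreath recursion of $g$ is $g=(g|_1,\dots,g|_d)\lambda_g$, where $\lambda_g\in S_d$ is the permutation induced by $g$ on $X$; it determines $g$. The group $G_d\le \mathrm{Aut}(T)$ is generated by $A=\{a_1,\dots,a_d\}$, defined recursively by: for $1\le i\le d-1$, $\lambda_{a_i}=(i\ \,i+1)$, $a_i|_i=a_i$, $a_i|_{i+1}=a_{i+1}$, and $a_i|_x=e$ for all other $x\in X$; and $\lambda_{a_d}=(d\ 1)$, $a_d|_1=a_1$, $a_d|_d=a_d$, and $a_d|_x=e$ for all other $x\in X$. The group $G_d$ is self-similar (all sections of its elements lie in $G_d$). $|g|_A\in\mathbb{Z}$ denotes the sum of all exponents of a word over $A\cup A^{-1}$ representing $g\in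 G_d$; it is known (for $d$ odd) that any word representing the identity has exponent sum $0$ in each generator, so $|g|_A$ is well defined. $\mathrm{St}_{G_d}(\widehat{k})$ is the subgroup of elements of $G_d$ fixing every vertex of $X^k$, and $\psi_k:\mathrm{St}_{G_d}(\widehat{k})\to G_d^{\,d^k}$ is the injective homomorphism $g\mapsto (g|_u)_{u\in X^k}$, with $X^k$ ordered lexicographically. For a vertex $u$, $\mathrm{Rist}_{G_d}(u)$ is the subgroup of elements of $G_d$ fixing every vertex not of the form $uv$ with $v\in X^*$; $\mathrm{Rist}_{G_d}(\widehat{k})$ is the subgroup generated by all $\mathrm{Rist}_{G_d}(u)$, $u\in X^k$. *)

(* Defs.v *)
From HB Require Import structures.
From mathcomp Require Import all_boot all_order all_algebra.
From mathcomp Require Import boolp classical_sets.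

Set Implicit Arguments.
Unset Strict Implicit.
Unset Printing Implicit Defensive.

Local Open Scope classical_set_scope.
Local Open Scope group_scope.

(** * The rooted tree on the finite words over 'I_d, and its automorphisms.
    The alphabet {1, ..., d} is encoded as 'I_d, the letter i being i - 1. *)

Definition tchild d (u v : seq 'I_d) : Prop := exists x, v = rcons u x.

Definition tadj d (u v : seq 'I_d) : Prop := tchild u v \/ tchild v u.

(* The inverse is carried by the record; it is determined by the underlying
   function, so it does not affect equality: see [tree_autP]. *)
Record tree_aut (d : nat) := TreeAut {
  taut_fun :> seq 'I_d -> seq 'I_d;
  taut_inv : seq 'I_d -> seq 'I_d;
  taut_funK : cancel taut_fun taut_inv;
  taut_invK : cancel taut_inv taut_fun;
  taut_root : taut_fun [::] = [::];
  taut_adj : forall u v, tadj u v <-> tadj (taut_fun u) (taut_fun v) }.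

Lemma tree_autP d (g h : tree_aut d) : g =1 h -> g = h.
Proof.
case: g h => [f f' fK f'K f0 fa] [g g' gK g'K g0 ga] /= /funext efg; subst g.
have e : f' = g' by apply: funext => u; rewrite -{2}[u]f'K gK.
by subst g'; congr TreeAut; exact: Prop_irrelevance.
Qed.

HB.instance Definition _ d := gen_eqMixin (tree_aut d).
HB.instance Definition _ d := gen_choiceMixin (tree_aut d).

Section Group.
Variable d : nat.
Implicit Types g h : tree_aut d.

Definition taut1 : tree_aut d :=
  @TreeAut d id id (fun=> erefl) (fun=> erefl) erefl (fun _ _ => iff_refl _).

Fact tautV_root g : taut_inv g [::] = [::].
Proof. by rewrite -{1}(taut_root g) taut_funK. Qed.

Fact tautV_adj g u v : tadj u v <-> tadj (taut_inv g u) (taut_inv g v).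
Proof. by rewrite (taut_adj g (taut_inv g u)) !taut_invK. Qed.

Definition tautV g : tree_aut d :=
  TreeAut (taut_invK g) (taut_funK g) (tautV_root g) (tautV_adj g).

Fact tautM_root g h : h (g [::]) = [::].
Proof. by rewrite !taut_root. Qed.

Fact tautM_adj g h u v : tadj u v <-> tadj (h (g u)) (h (g v)).
Proof. by rewrite (taut_adj g) (taut_adj h). Qed.

(* gh(u) = h(g(u)): automorphisms act from the right. *)
Definition tautM g h : tree_aut d :=
  @TreeAut d (h \o g) (taut_inv g \o taut_inv h)
    (can_comp (taut_funK h) (taut_funK g))
    (can_comp (taut_invK g) (taut_invK h))
    (tautM_root g h) (tautM_adj g h).

Fact tautMA : associative tautM.
Proof. by move=> g h k; exact: tree_autP. Qed.
Fact taut1M : left_id taut1 tautM.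
Proof. by move=> g; exact: tree_autP. Qed.
Fact tautM1 : right_id taut1 tautM.
Proof. by move=> g; exact: tree_autP. Qed.
Fact tautVM : left_inverse taut1 tautV tautM.
Proof. by move=> g; apply: tree_autP => u /=; rewrite taut_invK. Qed.
Fact tautMV : right_inverse taut1 tautV tautM.
Proof. by move=> g; apply: tree_autP => u /=; rewrite taut_funK. Qed.

HB.instance Definition _ :=
  isGroup.Build (tree_aut d) tautMA taut1M tautM1 tautVM tautMV.

Lemma tree_aut1E u : (1 : tree_aut d) u = u. Proof. by []. Qed.
Lemma tree_autME g h u : (g * h) u = h (g u). Proof. by []. Qed.
Lemma tree_autVE g u : g^-1 u = taut_inv g u. Proof. by []. Qed.

(** ** Sections *)

Lemma tree_aut_rcons g u x : exists y, g (rcons u x) = rcons (g u) y.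
Proof.
elim/last_ind: u x => [|u z IH] x.
  have [|[y ->]|[y]] := (taut_adj g [::] [:: x]).1.
  - by left; exists x.
  - by exists y.
  - by rewrite taut_root; case: (g _).
have [|//|[y gz]] := (taut_adj g (rcons u z) (rcons (rcons u z) x)).1.
  by left; exists x.
have [t gt] := IH z; move: gz; rewrite gt => /rcons_inj [/(can_inj (taut_funK g))].
move=> /(congr1 size) /eqP; rewrite !size_rcons -addn2 -{1}[size u]addn0.
by rewrite eqn_add2l.
Qed.

Lemma size_tree_aut g u : size (g u) = size u.
Proof.
elim/last_ind: u => [|u x IH]; first by rewrite taut_root.
by have [y ->] := tree_aut_rcons g u x; rewrite !size_rcons IH.
Qed.

Definition section_fun g (u v : seq 'I_d) : seq 'I_d := drop (size u) (g (u ++ v)).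

Lemma section_funE g u v : g (u ++ v) = g u ++ section_fun g u v.
Proof.
elim/last_ind: v => [|v x IH].
  by rewrite /section_fun cats0 drop_oversize ?cats0 ?size_tree_aut.
rewrite /section_fun -rcons_cat; have [y ->] := tree_aut_rcons g (u ++ v) x.
by rewrite IH rcons_cat -(size_tree_aut g u) drop_size_cat.
Qed.

Fact section_funK g u : cancel (section_fun g u) (section_fun g^-1 (g u)).
Proof.
move=> v; rewrite {1}/section_fun -section_funE tree_autVE taut_funK.
by rewrite size_tree_aut drop_size_cat.
Qed.

Fact section_invK g u : cancel (section_fun g^-1 (g u)) (section_fun g u).
Proof.
move=> v; have /(congr1 g) := section_funE g^-1 (g u) v.
rewrite !tree_autVE taut_invK taut_funK section_funE => /eqP.
by rewrite eqseq_cat // eqxx => /eqP/esym.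
Qed.

Fact section_root g u : section_fun g u [::] = [::].
Proof. by rewrite /section_fun cats0 drop_oversize ?size_tree_aut. Qed.

Fact tadj_cat (u v w : seq 'I_d) : tadj v w <-> tadj (u ++ v) (u ++ w).
Proof.
suff H v' w' : tchild v' w' <-> tchild (u ++ v') (u ++ w') by rewrite /tadj -!H.
split=> -[x]; first by move=> ->; exists x; rewrite rcons_cat.
move=> e; exists x; move: e; rewrite rcons_cat => /eqP.
by rewrite eqseq_cat // eqxx => /eqP.
Qed.

Fact section_adj g u v w :
  tadj v w <-> tadj (section_fun g u v) (section_fun g u w).
Proof. by rewrite (tadj_cat u) (taut_adj g) !section_funE -tadj_cat. Qed.

Definition tsection g (u : seq 'I_d) : tree_aut d :=
  TreeAut (section_funK g u) (section_invK g u) (section_root g u)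
    (section_adj g u).

Lemma tsectionE g u v : g (u ++ v) = g u ++ tsection g u v.
Proof. exact: section_funE. Qed.

Lemma tsection_uniq g h u : (forall v, g (u ++ v) = g u ++ h v) -> tsection g u = h.
Proof.
move=> H; apply: tree_autP => v; have := H v.
by rewrite tsectionE => /eqP; rewrite eqseq_cat // eqxx => /eqP.
Qed.

Lemma tsectionM g h u : tsection (g * h) u = tsection g u * tsection h (g u).
Proof. by apply: tsection_uniq => v; rewrite !tree_autME !tsectionE. Qed.

End Group.

(** * Generated subgroups *)

Definition is_subgroup (gT : groupType) (K : set gT) : Prop :=
  [/\ K 1, forall x y, K x -> K y -> K (x * y) & forall x, K x -> K x^-1].

Definition generated (gT : groupType) (S : set gT) : set gT :=
  smallest (@is_subgroup gT) S.

(** * The generators a_i and the group G_d *)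

(* [ordS] is the cyclic successor of 'I_d, so the two clauses of the recursive
   definition (i < d and i = d) are the same one: lambda_{a_i} = (i i+1),
   a_i|_i = a_i, a_i|_{i+1} = a_{i+1} and all other sections are trivial, with
   d + 1 read as 1.  See [gen_perm] and [gen_section]. *)
Fixpoint gen_fun d (i : 'I_d) (u : seq 'I_d) : seq 'I_d :=
  if u is x :: v then
    if x == i then ordS i :: gen_fun i v
    else if x == ordS i then i :: gen_fun (ordS i) v
    else u
  else [::].

Fixpoint gen_inv d (i : 'I_d) (u : seq 'I_d) : seq 'I_d :=
  if u is x :: v then
    if x == ordS i then i :: gen_inv i v
    else if x == i then ordS i :: gen_inv (ordS i) v
    else u
  else [::].

Section Generators.
Variable d : nat.
Implicit Types i x : 'I_d.

Fact gen_funK i : cancel (gen_fun i) (gen_inv i).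
Proof.
move=> u; elim: u i => [//|x v IH] i /=; case: (eqVneq x i) => [->|xi] /=.
  by rewrite eqxx IH.
case: (eqVneq x (ordS i)) => [xSi|xSi] /=.
  by rewrite -xSi eqxx [i == x]eq_sym (negPf xi) IH.
by rewrite (negPf xSi) (negPf xi).
Qed.

Fact gen_invK i : cancel (gen_inv i) (gen_fun i).
Proof.
move=> u; elim: u i => [//|x v IH] i /=; case: (eqVneq x (ordS i)) => [->|xSi] /=.
  by rewrite eqxx IH.
case: (eqVneq x i) => [xi|xi] /=.
  by rewrite -xi in xSi *; rewrite [ordS x == x]eq_sym (negPf xSi) eqxx IH.
by rewrite (negPf xSi) (negPf xi).
Qed.

Fact gen_root i : gen_fun i [::] = [::]. Proof. by []. Qed.

Fact gen_fun_child i u v : tchild u v -> tchild (gen_fun i u) (gen_fun i v).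
Proof.
case=> x ->; elim: u i => [|y u IH] i /=.
  by case: ifP => _; [|case: ifP => _]; eexists.
case: ifP => _; last case: ifP => _; last by exists x.
- by have [z ->] := IH i; exists z.
- by have [z ->] := IH (ordS i); exists z.
Qed.

Fact gen_inv_child i u v : tchild u v -> tchild (gen_inv i u) (gen_inv i v).
Proof.
case=> x ->; elim: u i => [|y u IH] i /=.
  by case: ifP => _; [|case: ifP => _]; eexists.
case: ifP => _; last case: ifP => _; last by exists x.
- by have [z ->] := IH i; exists z.
- by have [z ->] := IH (ordS i); exists z.
Qed.

Fact gen_adj i u v : tadj u v <-> tadj (gen_fun i u) (gen_fun i v).
Proof.
split=> -[] H; [left|right|left|right]; try exact: gen_fun_child.
- by rewrite -(gen_funK i u) -(gen_funK i v); exact: gen_inv_child.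
- by rewrite -(gen_funK i u) -(gen_funK i v); exact: gen_inv_child.
Qed.

Definition gen i : tree_aut d :=
  TreeAut (gen_funK i) (gen_invK i) (gen_root i) (gen_adj i).

Lemma gen_perm i x :
  gen i [:: x] = [:: if x == i then ordS i else if x == ordS i then i else x].
Proof. by rewrite /=; case: ifP => _; [|case: ifP => _]. Qed.

Lemma gen_section i x :
  tsection (gen i) [:: x] =
    if x == i then gen i else if x == ordS i then gen (ordS i) else 1.
Proof.
apply: tsection_uniq => v; rewrite gen_perm /=.
by case: ifP => _; [|case: ifP => _].
Qed.

End Generators.

Definition Ggrp (d : nat) : set (tree_aut d) := generated (range (@gen d)).
Arguments Ggrp : clear implicits.

(** * Exponent sums *)

(* A letter (i, b) of a word over A and its inverses stands for a_i if b is
   false and for a_i^-1 if b is true. *)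
Definition gword (d : nat) := seq ('I_d * bool).

Definition eval_gword d (w : gword d) : tree_aut d :=
  \prod_(l <- w) (if l.2 then (gen l.1)^-1 else gen l.1).

Definition word_expsum d (w : gword d) : int := (\sum_(l <- w) (-1) ^+ l.2)%R.

(* |g|_A: the exponent sum of a chosen word representing g.  For d odd and
   d >= 3 it does not depend on the word; every g in G_d has one, see
   [Ggrp_gword]. *)
Definition expsum d (g : tree_aut d) : int :=
  word_expsum (xget [::] [set w : gword d | eval_gword w = g]).

Lemma Ggrp_gword d (g : tree_aut d) : Ggrp d g <-> exists w, eval_gword w = g.
Proof.
split; last first.
  case=> w <- K [[K1 KM KV] KA]; rewrite /eval_gword.
  elim/big_ind: _ => // -[i b] _ /=.
  by case: b; [apply: (KV); apply: KA|apply: KA]; exists i.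
suff: Ggrp d `<=` [set g | exists w : gword d, eval_gword w = g] by exact.
apply: smallest_sub => [|_ [i _ <-]]; last first.
  by exists [:: (i, false)]; rewrite /eval_gword big_seq1.
split; first by exists [::]; rewrite /eval_gword big_nil.
- by move=> _ _ [v <-] [w <-]; exists (v ++ w); rewrite /eval_gword big_cat.
- move=> _ [w <-]; exists (rev [seq (l.1, ~~ l.2) | l <- w]).
  rewrite /eval_gword; elim: w => [|[i b] w IH]; first by rewrite !big_nil invg1.
  rewrite /= rev_cons -cats1 big_cat IH big_seq1 big_cons invgM /=.
  by case: b; rewrite ?invgK.
Qed.

(** * Stabilizers, rigid stabilizers and the maps psi_k *)

Definition stab_level d (k : nat) : set (tree_aut d) :=
  [set g | Ggrp d g /\ forall u : k.-tuple 'I_d, g u = u].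
Arguments stab_level : clear implicits.

Definition rist d (u : seq 'I_d) : set (tree_aut d) :=
  [set g | Ggrp d g /\
           forall w : seq 'I_d, ~ (exists v, w = u ++ v) -> g w = w].

Definition rist_level d (k : nat) : set (tree_aut d) :=
  generated (\bigcup_(u : k.-tuple 'I_d) rist u).
Arguments rist_level : clear implicits.

(* d^k-tuples of automorphisms are indexed by the level itself instead of by the
   rank in the lexicographic order.  psi_k is a homomorphism on [stab_level d k]
   only (see [psiM]), which contains [rist_level d k] (see
   [rist_level_sub_stab]). *)
Definition psi d (k : nat) (g : tree_aut d) : k.-tuple 'I_d -> tree_aut d :=
  fun u => tsection g u.
Arguments psi {d} k g _.

Lemma psiM d k (g h : tree_aut d) : stab_level d k g ->
  psi k (g * h) = fun u => psi k g u * psi k h u.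
Proof. by case=> _ gu; apply: funext => u; rewrite /psi tsectionM gu. Qed.

Lemma rist_level_sub_stab d k : rist_level d k `<=` stab_level d k.
Proof.
have G1 : Ggrp d 1 by move=> K [[]].
have GM g h : Ggrp d g -> Ggrp d h -> Ggrp d (g * h).
  by move=> Gg Gh K HK; have [[_ KM _] _] := HK; apply: KM; [apply: Gg|apply: Gh].
have GV g : Ggrp d g -> Ggrp d g^-1.
  by move=> Gg K HK; have [[_ _ KV] _] := HK; apply: KV; apply: Gg.
apply: smallest_sub => [|g [u _ [Gg gu]]].
  split=> // [g h [Gg gu] [Gh hu]|g [Gg gu]]; split=> [|u].
  - exact: GM.
  - by rewrite tree_autME gu hu.
  - exact: GV.
  - by rewrite tree_autVE -{1}(gu u) taut_funK.
have fix_ne (v : k.-tuple 'I_d) : v != u -> g v = v.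
  move=> vu; apply: gu => -[w vw]; move/negP: vu; apply; apply/eqP/val_inj => /=.
  rewrite vw; have := congr1 size vw; rewrite size_cat !size_tuple.
  by case: w {vw} => [|? ?]; rewrite ?cats0 // -{1}[k]addn0 => /addnI.
split=> // v; case: (eqVneq v u) => [->|]; last exact: fix_ne.
have sgu : size (g u) == k by rewrite size_tree_aut size_tuple.
case: (eqVneq (Tuple sgu) u) => [/(congr1 val)//|gu_u].
by have /(can_inj (taut_funK g)) := fix_ne _ gu_u.
Qed.

Definition Hgrp d (k : nat) : set (tree_aut d) :=
  [set w | Ggrp d w /\ (expsum w = 0 %[mod 2 ^+ k.+1])%Z].
Arguments Hgrp : clear implicits.

(* Main.v *)
Require Import Defs.
From mathcomp Require Import all_boot all_order all_fingroup all_algebra zify.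
From mathcomp Require Import boolp classical_sets.

Set Implicit Arguments.
Unset Strict Implicit.
Unset Printing Implicit Defensive.
Import GRing.Theory Num.Theory.

Local Open Scope classical_set_scope.
Local Open Scope group_scope.

(** Write |g| for the exponent sum, delta_x(g) for the automorphism that fixes
    the first level, has section g at x and trivial sections at the other
    letters, and K for the set of all g such that delta_x(g) lies in G_d for
    every letter x.

    Every generator has exactly two nontrivial sections at the first level,
    both of them generators, so the exponent sums of the first-level sections
    of g add up to 2|g| ([sum_expsum_section]).  If g is rigid at a vertex u of
    level k, then by iteration its section at u has exponent sum 2^k |g|
    ([expsum_rist]).  Moreover g fixes the first level, each generator acts
    there as a transposition, and hence |g| is even ([expsum_rist_even]).  So
    the sections of rigid elements lie in H_k.

    Conversely, it is enough that K contains every g with 4 | |g|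
    ([branching_expsum]): starting from w in H_k, one can then climb from u to
    the root one letter at a time, and each application of delta_x halves the
    exponent sum, which remains divisible by 4 as long as a letter is left
    ([rist_section_exists]).  As for K, it is a normal subgroup of G_d, because
    elements of G_d can carry any letter to any letter with any prescribed
    section ([carriesG]).  Write a, b, c for the generators with cyclically
    consecutive indices i, j, k.  The elements aba and bab induce the same
    permutation of the first level, and (aba)(bab)^-1 is delta_j of a conjugate
    of a c^-1; hence K contains a c^-1 ([branching_gen2]).  As d is
    odd, steps of length two reach every letter, and all generators become
    equal modulo K.  Finally (ab)^2 lies in K ([branching_gen_sqr]), so that
    G_d / K is cyclic of order dividing 4, generated by the image of any one
    generator, and g is congruent to the |g|-th power of that generator.

    The exponent sum has to be shown well defined first ([expsum_trivial]).
    Suppose a trivial word of minimal length n has nonzero exponent sum.  Its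
    sections are trivial words of length at most n, and by minimality only
    those of length exactly n can have nonzero exponent sum.  The section at a
    point of the first level has length n only if that point moves at every
    step, and two such points must keep exchanging places, which forces all
    letters of the word to have the same index.  Words of that kind are powers
    of one generator and are treated apart ([expsum_trivial_mono]).  Otherwise
    at most one section has length n, so it carries the whole exponent sum of
    the sections, twice that of the word ([trivial_double]).  Iterating, one
    finds trivial words of length n with exponent sum 2^k s for every k, where
    s is the initial one; this is absurd. *)

(** * Sections of words *)

Section Words.
Variable d : nat.
Implicit Types (i x y : 'I_d) (w : gword d) (g h : tree_aut d).

Definition letter (l : 'I_d * bool) : tree_aut d :=
  if l.2 then (gen l.1)^-1 else gen l.1.

Definition letter_perm (l : 'I_d * bool) : {perm 'I_d} := tperm l.1 (ordS l.1).

(** The inverse generators have their two sections exchanged: a section of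
    g^-1 at g(x) is the inverse of the section of g at x. *)
Definition letter_sec (l : 'I_d * bool) x : gword d :=
  if x == l.1 then [:: (if l.2 then ordS l.1 else l.1, l.2)]
  else if x == ordS l.1 then [:: (if l.2 then l.1 else ordS l.1, l.2)]
  else [::].

Fixpoint word_perm w : {perm 'I_d} :=
  if w is l :: v then letter_perm l * word_perm v else 1.

Fixpoint word_sec w x : gword d :=
  if w is l :: v then letter_sec l x ++ word_sec v (letter_perm l x) else [::].

Lemma eval_nil : eval_gword [::] = 1 :> tree_aut d.
Proof. exact: big_nil. Qed.

Lemma eval_cons l w : eval_gword (l :: w) = letter l * eval_gword w.
Proof. exact: big_cons. Qed.

Lemma eval_cat v w : eval_gword (v ++ w) = eval_gword v * eval_gword w.
Proof. exact: big_cat. Qed.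

Lemma eval_seq1 l : eval_gword [:: l] = letter l.
Proof. exact: big_seq1. Qed.

Lemma expsum_cons l w :
  word_expsum (l :: w) = ((-1) ^+ l.2 + word_expsum w)%R.
Proof. exact: big_cons. Qed.

Lemma expsum_cat v w :
  word_expsum (v ++ w) = (word_expsum v + word_expsum w)%R.
Proof. exact: big_cat. Qed.

Lemma gen_permE i x : gen i [:: x] = [:: tperm i (ordS i) x].
Proof.
by rewrite gen_perm permE /=; case: ifP => // _; case: ifP.
Qed.

Lemma tsection1 (u : seq 'I_d) : tsection 1 u = 1.
Proof. exact: tsection_uniq. Qed.

Lemma tsectionV g u : tsection g^-1 (g u) = (tsection g u)^-1.
Proof.
by rewrite -[LHS](mulKg (tsection g u)) -tsectionM mulgV tsection1 mulg1.
Qed.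

Lemma letter_permE l x : letter l [:: x] = [:: letter_perm l x].
Proof.
case: l => i []; last exact: gen_permE.
apply: (canLR (taut_funK (gen i))).
by rewrite gen_permE tpermK.
Qed.

Lemma letter_secE l x : tsection (letter l) [:: x] = eval_gword (letter_sec l x).
Proof.
case: l => i b; rewrite /letter /letter_sec /=; case: b; last first.
  by rewrite gen_section; case: ifP => _; [|case: ifP => _]; rewrite ?eval_seq1 ?eval_nil.
have xE : [:: x] = gen i [:: tperm i (ordS i) x] by rewrite gen_permE tpermK.
rewrite xE tsectionV gen_section.
case: tpermP => [->|->|/eqP/negPf xi /eqP/negPf xSi].
- by rewrite !eqxx; case: eqVneq => [->|_]; rewrite eval_seq1.
- by rewrite !eqxx; case: eqVneq => [->|_]; rewrite eval_seq1.
- by rewrite xi xSi eval_nil invg1.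
Qed.

Lemma word_permE w x : eval_gword w [:: x] = [:: word_perm w x].
Proof.
elim: w x => [|l w IH] x /=; first by rewrite eval_nil perm1.
by rewrite eval_cons tree_autME letter_permE IH permM.
Qed.

Lemma word_secE w x : tsection (eval_gword w) [:: x] = eval_gword (word_sec w x).
Proof.
elim: w x => [|l w IH] x /=; first by rewrite eval_nil tsection1.
by rewrite eval_cons tsectionM eval_cat letter_secE letter_permE IH.
Qed.

Lemma size_word_sec w x : (size (word_sec w x) <= size w)%N.
Proof.
elim: w x => // l w IH x /=; rewrite size_cat.
have := IH (letter_perm l x); rewrite /letter_sec.
by case: ifP => _ /=; [|case: ifP => _ /=]; lia.
Qed.

End Words.

(** * Cyclic successors *)

Lemma ordS_neq d (i : 'I_d) : (2 <= d)%N -> ordS i != i.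
Proof.
move=> d2; have := ltn_ord i; apply: contraTneq => /(congr1 val) /=.
move: (nat_of_ord i) => n; case: (ltngtP n.+1 d) => [lt|gt|e]; last by rewrite e modnn; lia.
- by rewrite modn_small; lia.
- lia.
Qed.

Lemma ordSS_neq d (i : 'I_d) : (3 <= d)%N -> ordS (ordS i) != i.
Proof.
move=> d2; have := ltn_ord i; apply: contraTneq => /(congr1 val) /=.
rewrite -addn1 modnDml addn1.
move: (nat_of_ord i) => n; case: (ltngtP n.+2 d) => [lt|gt|e]; last by rewrite e modnn; lia.
- by rewrite modn_small; lia.
- move=> e; apply/negP => nd; move: e; have -> : (n.+2 = 1 + d)%N by lia.
  by rewrite modnDr modn_small; lia.
Qed.

Lemma iter_ordS d n (x : 'I_d) : nat_of_ord (iter n (@ordS d) x) = ((x + n) %% d)%N.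
Proof.
elim: n => [|n IH]; first by rewrite addn0 modn_small.
by rewrite iterS /= IH -addn1 modnDml addn1 addnS.
Qed.

(** For d odd, 2 generates Z/d: the number of successor steps from x to y can
    be made even by adding d to it. *)
Lemma rel_of_ordS2 d (E : 'I_d -> 'I_d -> Prop) : odd d ->
  (forall x, E x x) -> (forall x y z, E x y -> E y z -> E x z) ->
  (forall x, E x (ordS (ordS x))) -> forall x y, E x y.
Proof.
move=> d_odd Er Et E2 x y.
have E2n n : E x (iter n.*2 (@ordS d) x).
  by elim: n => // n IH; apply: Et IH _; rewrite doubleS !iterS; apply: E2.
(* Adding d keeps the truncated subtraction exact and changes nothing mod d. *)
pose m := (y + d - x)%N.
have xm k : (iter (m + k * d) (@ordS d) x) = y.
  apply: val_inj; rewrite /= iter_ordS addnA addnC modnMDl /m.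
  have := ltn_ord x; have := ltn_ord y => yd xd.
  by rewrite subnKC; [rewrite modnDr modn_small|lia].
have [n nE] : exists n, n.*2 = (m + odd m * d)%N.
  exists (m + odd m * d)./2; rewrite -[RHS]odd_double_half oddD oddM d_odd.
  by case: (odd m).
by rewrite -(xm (odd m)) -nE.
Qed.

(** * Exponent sums of section words *)

(** A letter contributes one letter of its own sign to the section at each of
    the two points that it moves, and the sum over the remaining word does not
    see the permutation of the starting points. *)
Lemma sum_expsum_word_sec d (w : gword d) : (2 <= d)%N ->
  (\sum_x word_expsum (word_sec w x) = word_expsum w *+ 2)%R.
Proof.
move=> d2; elim: w => [|l w IH] /=.
  by rewrite /word_expsum big_nil mul0rn big1 // => x _; rewrite big_nil.
rewrite expsum_cons mulrnDl.
under eq_bigr => x _ do rewrite expsum_cat.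
rewrite big_split /=; congr (_ + _)%R; last first.
  by rewrite -IH [RHS](reindex_inj (@perm_inj _ (letter_perm l))).
rewrite (bigD1 l.1) //= (bigD1 (ordS l.1)) /= ?ordS_neq //.
rewrite /letter_sec !eqxx (negPf (ordS_neq _ d2)) big1 /=.
  by rewrite addr0 /word_expsum !big_seq1.
by move=> x /andP[/negPf-> /negPf->]; rewrite /word_expsum big_nil.
Qed.

Lemma expsum_le_size d (w : gword d) : (`|word_expsum w| <= (size w)%:Z)%R.
Proof.
elim: w => [|[i b] w IH]; first by rewrite /word_expsum big_nil.
by rewrite expsum_cons /=; case: b => /=; rewrite ?expr1 ?expr0; lia.
Qed.

(** * The exponent sum is well defined *)

Section WellDefined.
Variable d : nat.
Hypothesis d3 : (3 <= d)%N.
Implicit Types (i x y : 'I_d) (v w : gword d) (g h : tree_aut d).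

(** The section word at x is as long as the word itself only if the trajectory
    of x moves at every step. *)
Lemma full_word_sec_cons l w x : size (word_sec (l :: w) x) = (size w).+1 ->
  ((x == l.1) || (x == ordS l.1)) /\
  size (word_sec w (letter_perm l x)) = size w.
Proof.
rewrite /= size_cat; have := size_word_sec w (letter_perm l x).
by rewrite /letter_sec; case: eqP => _ /=; [|case: eqP => _ /=]; lia.
Qed.

(** The first letter exchanges x and y, so the same pair of points is exchanged
    again by every later letter. *)
Lemma full_word_sec2 w x y : x != y ->
  size (word_sec w x) = size w -> size (word_sec w y) = size w ->
  {in w, forall l, [set x; y] = [set l.1; ordS l.1]}%SET.
Proof.
elim: w x y => // l w IH x y xy /full_word_sec_cons[xl wx].
move=> /full_word_sec_cons[yl wy].
have xyE : [set x; y]%SET = [set l.1; ordS l.1]%SET.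
  by case/orP: xl xy => /eqP->; case/orP: yl => /eqP->; rewrite ?eqxx // finset.setUC.
move=> m; rewrite inE => /predU1P[->//|mw].
rewrite -(IH _ _ _ wx wy m mw) ?(inj_eq perm_inj) //.
rewrite /letter_perm; case/orP: xl xy => /eqP->; case/orP: yl => /eqP->;
  by rewrite ?eqxx // ?tpermL ?tpermR // finset.setUC.
Qed.

(** On three or more points, a cyclic edge determines its origin. *)
Lemma ordS_pair_inj i j : [set i; ordS i]%SET = [set j; ordS j]%SET -> i = j.
Proof.
move=> /setP e; have := e i; have := e (ordS i).
rewrite !inE !eqxx orbT /=.
move=> /esym/orP[/eqP<-|/eqP/(can_inj (ordSK (n:=_)))//].
by rewrite eq_sym (negPf (ordS_neq _ _)) 1?ltnW //= eq_sym (negPf (ordSS_neq _ _)).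
Qed.

Lemma trivial_word_sec w x : eval_gword w = 1 -> eval_gword (word_sec w x) = 1.
Proof. by move=> w1; rewrite -word_secE w1 tsection1. Qed.

(** At most one section of w keeps the full length, since two of them would
    make all indices equal.  The shorter sections have exponent sum 0, so the
    long one carries the total 2 * word_expsum w; without a long section,
    word_expsum w is itself 0 and w serves as v. *)
Lemma trivial_double w :
  (forall v, (size v < size w)%N -> eval_gword v = 1 -> word_expsum v = 0%R) ->
  eval_gword w = 1 -> ~ (exists i, {in w, forall l, l.1 = i}) ->
  exists v, [/\ size v = size w, eval_gword v = 1 &
                word_expsum v = (word_expsum w *+ 2)%R].
Proof.
move=> IH w1 nmono.
have short x : size (word_sec w x) != size w -> word_expsum (word_sec w x) = 0%R.
  move=> xw; apply: IH; last exact: trivial_word_sec.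
  by rewrite ltn_neqAle xw size_word_sec.
have sumE := sum_expsum_word_sec w (ltnW d3).
case: (pickP (fun x => size (word_sec w x) == size w)) => [x /eqP xw|nx]; last first.
  have: (word_expsum w *+ 2 = 0)%R.
    by rewrite -sumE big1 // => x _; exact: short (negbT (nx x)).
  by exists w; split=> //; lia.
exists (word_sec w x); split=> //; first exact: trivial_word_sec.
rewrite -sumE (bigD1 x) //= big1 ?addr0 // => y yx; apply: short.
apply/negP => /eqP yw; apply: nmono.
have xyE := full_word_sec2 yx yw xw.
case: w xyE {IH w1 sumE xw yw} => [|l w] xyE.
  by exists x.
exists l.1 => m mw; apply: ordS_pair_inj.
by rewrite -(xyE m mw) -(xyE l) // mem_head.
Qed.

(** The reduced word for the m-th power of a generator, m of either sign. *)
Definition gpower i (m : int) : gword d := nseq `|m|%N (i, (m < 0)%R).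

Lemma expsum_nseq n l : word_expsum (nseq n l : gword d) = ((-1) ^+ l.2 *+ n)%R.
Proof. by rewrite /word_expsum big_nseq iter_addr addr0. Qed.

Lemma eval_nseq n l : eval_gword (nseq n l : gword d) = letter l ^+ n.
Proof. by elim: n => //= [|n IH]; rewrite ?eval_nil // eval_cons IH expgS. Qed.

Lemma expsum_gpower i m : word_expsum (gpower i m) = m.
Proof. by rewrite expsum_nseq; case: m => m /=; rewrite ?expr1 ?expr0; lia. Qed.

Lemma eval_mono w i : {in w, forall l, l.1 = i} ->
  eval_gword w = eval_gword (gpower i (word_expsum w)).
Proof.
have gV n : (gen i)^-1 ^+ n.+1 * gen i = (gen i)^-1 ^+ n by rewrite expgSr mulgKV.
have gK n : gen i ^+ n.+1 * (gen i)^-1 = gen i ^+ n by rewrite expgSr mulgK.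
elim: w => [|[j b] w IH] wi; first by rewrite /word_expsum big_nil.
have ji : j = i by apply: (wi (j, b)); rewrite mem_head.
rewrite eval_cons expsum_cons IH => [|l lw]; last by apply: wi; rewrite inE lw orbT.
rewrite ji /gpower !eval_nseq /letter /=; move: (word_expsum w) => m {IH wi ji}.
have cm n : gen i * (gen i)^-1 ^+ n = (gen i)^-1 ^+ n * gen i.
  by apply: commuteX; apply: commuteV.
have cV n : (gen i)^-1 * gen i ^+ n = gen i ^+ n * (gen i)^-1.
  by apply: commuteX; apply/commute_sym/commuteV.
case: b; rewrite ?expr1 ?expr0.
- case: m => [[|m]|m].
  + by rewrite /= mulg1 expg1.
  + by rewrite /= cV gK; congr (_ ^+ _); lia.
  + have -> : (-1 + Negz m = Negz m.+1)%R by lia.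
    by rewrite /= -expgS.
- case: m => [m|[|m]].
  + have -> : (1 + Posz m = Posz m.+1)%R by lia.
    by rewrite /= -expgS.
  + by rewrite /= expg1 mulgV.
  + have -> : (1 + Negz m.+1 = Negz m)%R by lia.
    by rewrite /= cm gV.
Qed.

(** A power of a_i exchanges i and i + 1 at every step, so the sections at both
    points inherit its length and all its signs. *)
Lemma word_sec_nseq n i b x : (x == i) || (x == ordS i) ->
  size (word_sec (nseq n (i, b)) x) = n /\
  word_expsum (word_sec (nseq n (i, b)) x) = word_expsum (nseq n (i, b)).
Proof.
have Sii := negPf (ordS_neq i (ltnW d3)).
elim: n x => [|n IH] x xi //=.
have [|sz ex] := IH (letter_perm (i, b) x).
  by rewrite /letter_perm /=; case/orP: xi => /eqP->; rewrite ?tpermL ?tpermR eqxx ?orbT.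
rewrite size_cat expsum_cat expsum_cons sz ex /letter_sec /=.
case/orP: xi => /eqP->; rewrite ?Sii eqxx /= /word_expsum big_seq1 //.
Qed.

Lemma gen_neq1 i : gen i != 1.
Proof.
apply/eqP => /(congr1 (fun g : tree_aut d => g [:: i])).
by rewrite gen_permE tpermL => -[/eqP]; rewrite (negPf (ordS_neq i (ltnW d3))).
Qed.

Lemma letter_neq1 l : letter l != 1 :> tree_aut d.
Proof. by case: l => i []; rewrite /letter /= ?invg_eq1 gen_neq1. Qed.

(** The word may be replaced by a power of a_i with the same exponent sum m, of
    length |m|.  If that does not make it shorter, and |m| > 1, then its section
    at i alternates between the indices i and i + 1 and is again a trivial word
    of length |m| and exponent sum m.  By [trivial_double] there would be a
    trivial word of length |m| and exponent sum 2m. *)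
Lemma expsum_trivial_mono w i :
  (forall v, (size v < size w)%N -> eval_gword v = 1 -> word_expsum v = 0%R) ->
  {in w, forall l, l.1 = i} -> eval_gword w = 1 -> word_expsum w = 0%R.
Proof.
move=> IH wi w1; have := eval_mono wi; rewrite w1 => /esym.
have := expsum_le_size w; have := expsum_gpower i (word_expsum w).
move: (word_expsum w) => m; rewrite /gpower; set b := (m < 0)%R.
move en : `|m|%N => n mE mw W1.
have [nw|nw] := ltnP n (size w).
  by rewrite -mE; apply: IH => //; rewrite size_nseq.
have {mw nw} wn : size w = n by lia.
case: n => [|[|n]] in en mE W1 wn *; first by lia.
  by move: W1; rewrite eval_seq1 => /eqP; rewrite (negPf (letter_neq1 _)).
have [|sU eU] := word_sec_nseq n.+2 b (x := i) (i := i); first by rewrite eqxx.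
have U1 := trivial_word_sec i W1.
(* The first two letters of the section at i have indices i and i + 1. *)
have [||v [sv _ ev]] := trivial_double _ U1.
- by move=> v; rewrite sU -wn; apply: IH.
- case=> j; rewrite /= /letter_perm /= tpermL /letter_sec /= eqxx.
  rewrite (negPf (ordS_neq i (ltnW d3))) eqxx /= => U.
  have := ordS_neq i (ltnW d3).
  have Uj : (if b then i else ordS i) = j.
    by apply: (U (_, b)); rewrite !inE eqxx orbT.
  by rewrite -Uj in U; have /= := U _ (mem_head _ _); case: (b) => [->|<-]; rewrite eqxx.
- have := expsum_le_size v; rewrite sv ev eU sU mE; lia.
Qed.

Lemma expsum_trivial w : eval_gword w = 1 -> word_expsum w = 0%R.
Proof.
have [n] := ubnP (size w); elim: n w => // n IH w; rewrite ltnS => wn w1.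
have {}IH v : (size v < size w)%N -> eval_gword v = 1 -> word_expsum v = 0%R.
  by move=> vw; apply: IH; apply: leq_trans vw wn.
(* If v uses a single index, its exponent sum is 0 and v is its own double. *)
have dbl k : exists v, [/\ size v = size w, eval_gword v = 1 &
    word_expsum v = (word_expsum w *+ 2 ^ k)%R].
  elim: k => [|k [v [sv v1 ev]]]; first by exists w.
  rewrite expnSr mulrnA -ev; rewrite -sv in IH *.
  have [[i vi]|nmono] := pselect (exists i, {in v, forall l, l.1 = i}).
    by exists v; rewrite (expsum_trivial_mono IH vi v1).
  by have [u [su u1 eu]] := trivial_double IH v1 nmono; exists u; rewrite su.
have [v [sv _ ev]] := dbl (size w).
have := expsum_le_size v; rewrite sv ev -mulr_natr normrM.
have := ltn_expl (size w) (ltnSn 1); move: (2 ^ _)%N => N.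
move: (word_expsum w) (size w) => m s; nia.
Qed.
End WellDefined.

(** * The exponent sum on the group *)

Section ExponentSum.
Variable d : nat.
Hypothesis d3 : (3 <= d)%N.
Implicit Types (i x y : 'I_d) (v w : gword d) (g h : tree_aut d).

Lemma Ggrp_eval w : Ggrp d (eval_gword w).
Proof. by apply/Ggrp_gword; exists w. Qed.

Lemma Ggrp1 : Ggrp d 1.
Proof. by rewrite -eval_nil; exact: Ggrp_eval. Qed.

Lemma GgrpM g h : Ggrp d g -> Ggrp d h -> Ggrp d (g * h).
Proof.
by move=> /Ggrp_gword[v <-] /Ggrp_gword[w <-]; rewrite -eval_cat; exact: Ggrp_eval.
Qed.

Lemma GgrpV g : Ggrp d g -> Ggrp d g^-1.
Proof. by move=> Gg K HK; have [[_ _ KV] _] := HK; apply: KV; apply: Gg. Qed.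

Lemma Ggrp_letter l : Ggrp d (letter l).
Proof. by rewrite -eval_seq1; exact: Ggrp_eval. Qed.

Lemma Ggrp_gen i : Ggrp d (gen i).
Proof. exact: Ggrp_letter (i, false). Qed.

Lemma Ggrp_section1 g x : Ggrp d g -> Ggrp d (tsection g [:: x]).
Proof. by move=> /Ggrp_gword[w <-]; rewrite word_secE; exact: Ggrp_eval. Qed.

Definition inv_gword w : gword d := rev [seq (l.1, ~~ l.2) | l <- w].

Lemma letterV l : letter (l.1, ~~ l.2) = (letter l)^-1 :> tree_aut d.
Proof. by case: l => i []; rewrite /letter /= ?invgK. Qed.

Lemma eval_inv w : eval_gword (inv_gword w) = (eval_gword w)^-1.
Proof.
elim: w => [|l w IH]; first by rewrite eval_nil invg1.
by rewrite /inv_gword /= rev_cons -cats1 eval_cat IH eval_seq1 letterV eval_cons invgM.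
Qed.

Lemma expsum_inv w : word_expsum (inv_gword w) = (- word_expsum w)%R.
Proof.
elim: w => [|l w IH]; first by rewrite /word_expsum big_nil oppr0.
rewrite /inv_gword /= rev_cons -cats1 expsum_cat IH !expsum_cons.
by rewrite {2}/word_expsum big_nil; case: l => i [] /=; rewrite ?expr0 ?expr1; lia.
Qed.

Lemma expsumE w : expsum (eval_gword w) = word_expsum w.
Proof.
rewrite /expsum; case: xgetP => [v _ /= vw|/(_ w)/=]; last by [].
have := @expsum_trivial d d3 (v ++ inv_gword w).
rewrite eval_cat eval_inv vw mulgV expsum_cat expsum_inv => /(_ erefl) /eqP.
by rewrite subr_eq0 => /eqP.
Qed.

Lemma expsum1 : expsum (1 : tree_aut d) = 0%R.
Proof. by rewrite -eval_nil expsumE /word_expsum big_nil. Qed.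

Lemma expsumM g h : Ggrp d g -> Ggrp d h ->
  expsum (g * h) = (expsum g + expsum h)%R.
Proof.
move=> /Ggrp_gword[v <-] /Ggrp_gword[w <-].
by rewrite -eval_cat !expsumE expsum_cat.
Qed.

Lemma expsumV g : Ggrp d g -> expsum g^-1 = (- expsum g)%R.
Proof. by move=> /Ggrp_gword[v <-]; rewrite -eval_inv !expsumE expsum_inv. Qed.

Lemma sum_expsum_section g : Ggrp d g ->
  (\sum_x expsum (tsection g [:: x]) = expsum g *+ 2)%R.
Proof.
move=> /Ggrp_gword[w <-]; rewrite expsumE -sum_expsum_word_sec ?(ltnW d3) //.
by apply: eq_bigr => x _; rewrite word_secE expsumE.
Qed.

Lemma odd_word_perm w : odd_perm (word_perm w) = odd (size w).
Proof.
elim: w => [|l w IH] /=; first by rewrite odd_perm1.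
by rewrite odd_permM IH odd_tperm eq_sym (ordS_neq _ (ltnW d3)).
Qed.

Lemma expsum_parity w : (2 %| (word_expsum w - (size w)%:Z)%R)%Z.
Proof.
elim: w => [|[i b] w IH]; first by rewrite /word_expsum big_nil.
by rewrite expsum_cons /=; case: b; rewrite ?expr0 ?expr1; lia.
Qed.

(** Each letter acts on the first level as a transposition, so the parity of
    the length, which is that of the exponent sum, is the sign of the
    permutation of the first level. *)
Lemma expsum_even g : Ggrp d g -> (forall x, g [:: x] = [:: x]) ->
  (2 %| expsum g)%Z.
Proof.
move=> /Ggrp_gword[w <-] wfix; rewrite expsumE.
have w1 : word_perm w = 1.
  by apply/permP => x; rewrite perm1; have := wfix x; rewrite word_permE => -[].
have := odd_word_perm w; rewrite w1 odd_perm1; have := expsum_parity w; lia.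
Qed.
End ExponentSum.

(** * The branching subgroup K *)

Section Branching.
Variable d : nat.
Hypothesis d3 : (3 <= d)%N.
Hypothesis d_odd : odd d.
Implicit Types (i x y : 'I_d) (v w : gword d) (g h : tree_aut d).

Let d_gt0 : (0 < d)%N. Proof. exact: leq_trans d3. Qed.

Definition carries x y g :=
  exists h, [/\ Ggrp d h, h [:: x] = [:: y] & tsection h [:: x] = g].

Lemma carriesM x y z g h : carries x y g -> carries y z h -> carries x z (g * h).
Proof.
move=> [g' [Gg gx <-]] [h' [Gh hy <-]]; exists (g' * h').
by split; [exact: GgrpM|rewrite tree_autME gx|rewrite tsectionM gx].
Qed.

Lemma carriesV x y g : carries x y g -> carries y x g^-1.
Proof.
move=> [g' [Gg gx <-]]; exists g'^-1; rewrite -gx tsectionV; split=> //.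
  exact: GgrpV.
by rewrite tree_autVE taut_funK.
Qed.

(** Going from i to i + 1, the generator a_i has section a_i, while its inverse
    has section a_{i+1}^-1.  Hence i can be carried to i + 2 by a_i^-1 a_{i+1}
    with section a_{i+1}^-1 a_{i+1} = 1, and d is odd. *)
Lemma carries1 x y : carries x y 1.
Proof.
move: x y; apply: (rel_of_ordS2 (E := fun x y => carries x y 1) d_odd) => [x|x y z xy yz|x].
- by exists 1; rewrite tsection1; split=> //; exact: Ggrp1.
- by rewrite -[1]mulg1; apply: carriesM yz.
have carries_gen i : carries i (ordS i) (gen i).
  exists (gen i); rewrite gen_permE tpermL gen_section eqxx; split=> //.
  exact: Ggrp_gen.
have carries_genV i : carries i (ordS i) (gen (ordS i))^-1.
  apply: carriesV; exists (gen i).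
  rewrite gen_permE tpermR gen_section eqxx (negPf (ordS_neq i (ltnW d3))).
  by split=> //; exact: Ggrp_gen.
by rewrite -(mulVg (gen (ordS x))); apply: carriesM (carries_gen _).
Qed.

(** By [carries1] the endpoints can be changed freely without altering the
    section, so it is enough to have each generator as a section somewhere. *)
Lemma carriesG x y g : Ggrp d g -> carries x y g.
Proof.
have cgen i : carries x x (gen i).
  rewrite -[gen i]mulg1 -[gen i]mul1g; apply: carriesM (carries1 (ordS i) x).
  apply: carriesM (carries1 x i) _; exists (gen i).
  by rewrite gen_permE tpermL gen_section eqxx; split=> //; exact: Ggrp_gen.
move=> /Ggrp_gword[w <-]; rewrite -[eval_gword w]mulg1.
apply: carriesM (carries1 x y); elim: w => [|[i b] w IH].
  by rewrite eval_nil; exact: carries1.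
rewrite eval_cons; apply: carriesM IH.
by case: b; [apply: carriesV|]; exact: cgen.
Qed.

Definition stab1_with (f : 'I_d -> tree_aut d) g :=
  Ggrp d g /\ forall y, g [:: y] = [:: y] /\ tsection g [:: y] = f y.

Lemma stab1_withM f1 f2 g1 g2 : stab1_with f1 g1 -> stab1_with f2 g2 ->
  stab1_with (fun y => f1 y * f2 y) (g1 * g2).
Proof.
move=> [G1 H1] [G2 H2]; split=> [|y]; first exact: GgrpM.
have [g1y <-] := H1 y; have [g2y <-] := H2 y.
by rewrite tree_autME g1y g2y tsectionM g1y.
Qed.

Lemma stab1_withV f g : stab1_with f g -> stab1_with (fun y => (f y)^-1) g^-1.
Proof.
move=> [G H]; split=> [|y]; first exact: GgrpV.
have [gy <-] := H y; split; first by rewrite tree_autVE -{1}gy taut_funK.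
by rewrite -{1}gy tsectionV.
Qed.

Lemma stab1_with_ext f1 f2 g : f1 =1 f2 -> stab1_with f1 g -> stab1_with f2 g.
Proof. by move=> f12 [Gg H]; split=> // y; rewrite -f12. Qed.

(** Together with [stab1_with] this describes delta_x(g). *)
Definition at_vertex x g : 'I_d -> tree_aut d := fun y => if y == x then g else 1.

(** The subgroup K, over which G_d branches. *)
Definition branching g := forall x, exists h, stab1_with (at_vertex x g) h.

Lemma branchingM g h : branching g -> branching h -> branching (g * h).
Proof.
move=> Kg Kh x; have [g' Hg] := Kg x; have [h' Hh] := Kh x.
exists (g' * h'); have [Ggh H] := stab1_withM Hg Hh; split=> // y.
by have [-> ->] := H y; rewrite /at_vertex; case: eqP; rewrite ?mulg1.
Qed.

Lemma branchingV g : branching g -> branching g^-1.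
Proof.
move=> Kg x; have [g' Hg] := Kg x.
exists g'^-1; have [Gg H] := stab1_withV Hg; split=> // y.
by have [-> ->] := H y; rewrite /at_vertex; case: eqP; rewrite ?invg1.
Qed.

Lemma branching1 : branching 1.
Proof.
move=> x; exists 1; split=> [|y]; first exact: Ggrp1.
by rewrite tsection1 /at_vertex; case: ifP.
Qed.

(** Conjugating delta_x(g) by an element that carries x to z with section s
    yields delta_z of the conjugate of g by s; this gives at once the normality
    of K and its independence of the letter. *)
Lemma branching_conj_at x g s : Ggrp d s -> (exists h, stab1_with (at_vertex x g) h) ->
  branching (s^-1 * g * s).
Proof.
move=> Gs [h [Gh H]] z; have [t [Gt tx <-]] := carriesG x z Gs.
exists (t^-1 * h * t); split; first by do 2?apply: GgrpM => //; exact: GgrpV.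
move=> y; have [y' ty'] : exists y', t [:: y'] = [:: y].
  have /Ggrp_gword[w wt] := Gt; exists ((word_perm w)^-1 y).
  by rewrite -wt word_permE permKV.
have Vy : t^-1 [:: y] = [:: y'] by rewrite -ty' tree_autVE taut_funK.
have [hy' sh] := H y'; rewrite !tree_autME Vy hy' ty'; split=> //.
rewrite !tsectionM tree_autME Vy hy' sh -ty' tsectionV /at_vertex.
have -> : (y == z) = (y' == x).
  apply/eqP/eqP => [yz|y'x]; last by move: ty'; rewrite y'x tx => -[].
  have : t [:: y'] = t [:: x] by rewrite ty' tx yz.
  by move/(can_inj (taut_funK t)) => [].
by case: eqP => [->|_] //; rewrite mulg1 mulVg.
Qed.

Lemma branching_vertex x g : (exists h, stab1_with (at_vertex x g) h) -> branching g.
Proof.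
by move=> /(branching_conj_at (@Ggrp1 d)); rewrite invg1 mul1g mulg1.
Qed.

Lemma branching_conj g s : Ggrp d s -> branching g -> branching (s^-1 * g * s).
Proof. by move=> Gs Kg; apply: (branching_conj_at Gs) (Kg (Ordinal d_gt0)). Qed.

Lemma branching_conjV g s : Ggrp d s -> branching g -> branching (s * g * s^-1).
Proof.
move=> Gs Kg; have := branching_conj (GgrpV Gs) Kg.
by rewrite invgK.
Qed.

Lemma stab1_with_word f w :
  (forall y, word_perm w y = y /\ eval_gword (word_sec w y) = f y) ->
  stab1_with f (eval_gword w).
Proof.
move=> H; split=> [|y]; first exact: Ggrp_eval.
by have [wy <-] := H y; rewrite word_permE wy word_secE.
Qed.

Lemma ordS_neqE i : (((ordS i == i) = false) * ((i == ordS i) = false) *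
  ((ordS (ordS i) == i) = false) * ((i == ordS (ordS i)) = false) *
  ((ordS (ordS i) == ordS i) = false) * ((ordS i == ordS (ordS i)) = false))%type.
Proof.
have Si := negPf (ordS_neq i (ltnW d3)).
have SSi := negPf (ordS_neq (ordS i) (ltnW d3)).
have S2i := negPf (ordSS_neq i d3).
by do !split=> //; rewrite eq_sym.
Qed.

(** The witness is the word a_i a_j a_i (a_j a_i a_j)^-1: both factors induce
    the transposition of i and k, and their sections differ at j only. *)
Lemma branching_gen2 i : branching (gen i * (gen (ordS (ordS i)))^-1).
Proof.
set j := ordS i; set k := ordS j.
pose w : gword d := [:: (i, false); (j, false); (i, false);
                        (j, true); (i, true); (j, true)].
have : branching (gen j * gen i * (gen k)^-1 * (gen j)^-1).
  apply: (branching_vertex (x := j)); exists (eval_gword w).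
  apply: stab1_with_word => y; rewrite /at_vertex /= /letter_perm /letter_sec /= !permM.
  have E := (ordS_neqE i, eqxx, permE, eval_cons, eval_nil); rewrite -/j -/k in E *.
  have [->|yi] := eqVneq y i.
    by do !rewrite !E /=; rewrite /letter /= !mulgA mulg1 mulgK mulgV.
  have [->|yj] := eqVneq y j.
    by do !rewrite !E /=; rewrite /letter /= !mulgA mulg1.
  have [->|yk] := eqVneq y k.
    by do !rewrite !E /=; rewrite /letter /= !mulgA mulg1 mulgK mulgV.
  by do !rewrite ?(negPf yi) ?(negPf yj) ?(negPf yk) ?E /=.
move/(branching_conj (Ggrp_gen j)).
by rewrite !mulgA mulVg mul1g mulgKV.
Qed.

(** The word a_i^2 a_j^-1 a_i^2 a_j^-1 is the product of a_i^2, of its conjugate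
    by a_j, and of a_j^-2.  The first two both have section a_i a_j at i, and
    their other sections, at j and at k, are cancelled up to K by those of
    a_j^-2.  The remaining sections, in K by [branching_gen2], are then removed
    within G_d. *)
Lemma branching_gen_sqr i :
  branching (gen i * gen (ordS i) * gen i * gen (ordS i)).
Proof.
set j := ordS i; set k := ordS j.
have Kik : branching (gen i * (gen k)^-1) := branching_gen2 i.
have Kjik : branching (gen j * gen i * (gen k)^-1 * (gen j)^-1).
  by have := branching_conjV (Ggrp_gen j) Kik; rewrite !mulgA.
pose w : gword d := [:: (i, false); (i, false); (j, true);
                        (i, false); (i, false); (j, true)].
have [hj Hj] := Kjik j; have [hk Hk] := Kik k.
apply: (branching_vertex (x := i)); exists (eval_gword w * hj^-1 * hk^-1).
pose f y := if y == i then gen i * gen j * gen i * gen j else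
  if y == j then gen j * gen i * (gen k)^-1 * (gen j)^-1 else
  if y == k then gen i * (gen k)^-1 else 1.
have E := (ordS_neqE i, eqxx, permE, eval_cons, eval_nil); rewrite -/j -/k in E *.
have Hw : stab1_with f (eval_gword w).
  apply: stab1_with_word => y; rewrite /f /= /letter_perm /letter_sec /= !permM.
  rewrite -/j -/k; have [->|yi] := eqVneq y i.
    by do !rewrite !E /=; rewrite /letter /= !mulgA mulg1.
  have [->|yj] := eqVneq y j.
    by do !rewrite !E /=; rewrite /letter /= !mulgA mulg1.
  have [->|yk] := eqVneq y k.
    by do !rewrite !E /=; rewrite /letter /= !mulgA mulg1 mulVg mul1g.
  by do !rewrite ?(negPf yi) ?(negPf yj) ?(negPf yk) ?E /=.
apply: stab1_with_ext (stab1_withM (stab1_withM Hw (stab1_withV Hj)) (stab1_withV Hk)) => y.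
rewrite /f /at_vertex; have [->|yi] := eqVneq y i.
  by rewrite !E invg1 !mulg1.
have [->|yj] := eqVneq y j; first by rewrite !E invg1 mulg1 mulgV.
by case: eqP => _; rewrite invg1 mulg1 ?mulgV ?invg1 ?mulg1.
Qed.

Definition branching_cong g h := branching (g * h^-1).

Lemma branching_cong_refl g : branching_cong g g.
Proof. by rewrite /branching_cong mulgV; exact: branching1. Qed.

Lemma branching_cong_trans g h l :
  branching_cong g h -> branching_cong h l -> branching_cong g l.
Proof. by move=> gh hl; have := branchingM gh hl; rewrite mulgA mulgKV. Qed.

Lemma branching_congM g g' h h' :
  Ggrp d g -> branching_cong g g' -> branching_cong h h' ->
  branching_cong (g * h) (g' * h').
Proof.
move=> Gg gg hh; rewrite /branching_cong invgM.
by have := branchingM (branching_conjV Gg hh) gg; rewrite !mulgA mulgKV.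
Qed.

Lemma branching_cong_gen x y : branching_cong (gen x) (gen y).
Proof.
pose E x y := branching_cong (gen x) (gen y).
move: x y; apply: (rel_of_ordS2 (E := E) d_odd) => [x|x y z|x].
- exact: branching_cong_refl.
- exact: branching_cong_trans.
- exact: branching_gen2.
Qed.

Lemma branching_cong_branching g h : branching_cong g h -> branching h -> branching g.
Proof. by move=> gh Kh; have := branchingM gh Kh; rewrite mulgKV. Qed.

Lemma branching_gen4 i : branching (gen i ^+ 4).
Proof.
apply: branching_cong_branching (branching_gen_sqr i).
rewrite !expgS expg0 mulg1 -!mulgA.
have Gi := Ggrp_gen i; have c := branching_cong_gen i.
by do 3!apply: (branching_congM Gi (c _)) => //.
Qed.

(** Modulo K the inverse of a generator is its cube, so natural exponents
    suffice. *)
Lemma branching_cong_word w i :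
  exists m, branching_cong (eval_gword w) (gen i ^+ m) /\
            (4 %| (word_expsum w - m%:Z)%R)%Z.
Proof.
elim: w => [|l w [m [wm sm]]].
  exists 0; rewrite eval_nil expg0 /word_expsum big_nil; split=> //.
  exact: branching_cong_refl.
have step n : branching_cong (letter l) (gen i ^+ n) ->
    (4 %| ((-1) ^+ l.2 - n%:Z)%R)%Z ->
    exists m, branching_cong (eval_gword (l :: w)) (gen i ^+ m) /\
              (4 %| (word_expsum (l :: w) - m%:Z)%R)%Z.
  move=> ln sn; exists (n + m)%N; rewrite eval_cons expsum_cons expgD; split.
    exact: branching_congM (Ggrp_letter l) ln wm.
  by move: sm sn; move: ((-1) ^+ _)%R => e; lia.
case: l step => j [] /= step; last first.
  by apply: (step 1%N); [rewrite expg1; exact: branching_cong_gen|rewrite expr0].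
apply: (step 3%N); last by rewrite expr1.
rewrite /letter /= /branching_cong.
have <- : (gen i ^+ 3 * gen j)^-1 = (gen j)^-1 * (gen i ^+ 3)^-1 by rewrite invgM.
apply: branchingV; apply: branching_cong_branching (branching_gen4 i).
rewrite (expgSr (gen i) 3).
apply: branching_congM (branching_cong_refl _) (branching_cong_gen _ _).
by rewrite -(eval_nseq 3 (i, false)); exact: Ggrp_eval.
Qed.

Lemma branching_expsum g : Ggrp d g -> (4 %| expsum g)%Z -> branching g.
Proof.
move=> /Ggrp_gword[w <-]; rewrite expsumE // => s4.
have [m [wm sm]] := branching_cong_word w (Ordinal d_gt0).
apply: branching_cong_branching wm _.
have [n ->] : exists n, m = (4 * n)%N by exists (m %/ 4)%N; lia.
rewrite expgM; elim: n => [|n IH]; first by rewrite expg0; exact: branching1.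
by rewrite expgS; apply: branchingM IH; exact: branching_gen4.
Qed.

End Branching.

(** * Rigid stabilizers *)

Section Rist.
Variable d : nat.
Hypothesis d3 : (3 <= d)%N.
Implicit Types (x y : 'I_d) (u v : seq 'I_d) (g h : tree_aut d).

Lemma tsection_nil g : tsection g [::] = g.
Proof. by apply: tsection_uniq => v; rewrite taut_root. Qed.

Lemma tsection_cons g x u : tsection g (x :: u) = tsection (tsection g [:: x]) u.
Proof.
by apply: tsection_uniq => v; rewrite -[x :: u]cat1s -catA !tsectionE catA.
Qed.

Lemma Ggrp_section g u : Ggrp d g -> Ggrp d (tsection g u).
Proof.
elim: u g => [|x u IH] g Gg; first by rewrite tsection_nil.
by rewrite (tsection_cons g x u); apply: IH; exact: Ggrp_section1.
Qed.

Lemma rist_cons g x u : rist (x :: u) g <->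
  stab1_with (at_vertex x (tsection g [:: x])) g /\ rist u (tsection g [:: x]).
Proof.
split=> [[Gg gu]|[[Gg H] [_ gu]]]; last first.
  split=> // -[|y v] nu; first by rewrite taut_root.
  have [gy sy] := H y; rewrite -cat1s tsectionE gy sy /at_vertex.
  case: eqP => [yx|_] //; rewrite gu // => -[t vt]; apply: nu.
  by exists t; rewrite yx vt.
have fixy y v : y != x -> g (y :: v) = y :: v.
  by move=> yx; apply: gu => -[t [yx']]; rewrite yx' eqxx in yx.
have gx : g [:: x] = [:: x].
  have [w gE] := (Ggrp_gword g).1 Gg; have := word_permE w x; rewrite gE => gx.
  have [px|px] := eqVneq (word_perm w x) x; first by rewrite gx px.
  by have := fixy _ [::] px; rewrite -gx => /(can_inj (taut_funK g)).
split; split=> //; last 2 first.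
- exact: Ggrp_section1.
- move=> v nv; have : g (x :: v) = x :: v.
    by apply: gu => -[t [vt]]; apply: nv; exists t.
  by rewrite -cat1s tsectionE gx => -[].
move=> y; rewrite /at_vertex; have [->//|yx] := eqVneq y x.
split; first exact: fixy.
by apply: tsection_uniq => v; rewrite !fixy.
Qed.

Lemma expsum_at_vertex x f g : stab1_with (at_vertex x f) g ->
  expsum f = (expsum g *+ 2)%R.
Proof.
move=> [Gg H]; rewrite -sum_expsum_section // (bigD1 x) //= big1 => [|y yx].
  by have [_ ->] := H x; rewrite /at_vertex eqxx addr0.
by have [_ ->] := H y; rewrite /at_vertex (negPf yx) expsum1.
Qed.

Lemma expsum_rist u g : rist u g ->
  expsum (tsection g u) = (expsum g * 2 ^+ size u)%R.
Proof.
elim: u g => [|x u IH] g; first by rewrite tsection_nil expr0 mulr1.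
move=> /rist_cons[Hg /IH]; rewrite (tsection_cons g x u) => ->.
by rewrite (expsum_at_vertex Hg) exprS mulrA mulr_natr.
Qed.

Lemma expsum_rist_even u g : (0 < size u)%N -> rist u g -> (2 %| expsum g)%Z.
Proof.
case: u => // x u _ /rist_cons[[Gg H] _].
by apply: expsum_even => // y; have [] := H y.
Qed.

Lemma expsum_rist_section u g : (0 < size u)%N -> rist u g ->
  ((2 ^+ (size u).+1)%R %| expsum (tsection g u))%Z.
Proof.
move=> u0 Hg; rewrite expsum_rist // exprS.
by apply: dvdz_mul => //; exact: expsum_rist_even Hg.
Qed.

(** Induction on u: the rigid element g obtained below the first letter has
    |w| = |g| 2^(size u), so that 4 divides |g| and g lies in K. *)
Lemma rist_section_exists u w : odd d -> Ggrp d w ->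
  ((2 ^+ (size u).+1)%R %| expsum w)%Z ->
  exists g, rist u g /\ tsection g u = w.
Proof.
move=> d_odd Gw; elim: u => [|x u IH] /= dvd_w.
  by exists w; rewrite tsection_nil; split=> //; split=> // v []; exists v.
have [|g [Hg gw]] := IH.
  by apply: dvdz_trans dvd_w; rewrite exprS; apply: dvdz_mull.
have g4 : (4 %| expsum g)%Z.
  have := expsum_rist Hg; rewrite gw => ew; move: dvd_w.
  by rewrite ew !exprS mulrA dvdz_mul2r // expf_neq0.
have [Gg _] := Hg.
have [h Hh] := branching_expsum d3 d_odd Gg g4 x.
have hx : tsection h [:: x] = g.
  by have [_ H] := Hh; have [_ ->] := H x; rewrite /at_vertex eqxx.
exists h; rewrite (tsection_cons h x u) hx; split=> //.
by apply/rist_cons; rewrite hx.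
Qed.

Lemma HgrpE k g : Hgrp d k g <-> Ggrp d g /\ ((2 ^+ k.+1)%R %| expsum g)%Z.
Proof.
by split=> -[Gg e]; split=> //; move: e; rewrite mod0z => /dvdz_mod0P.
Qed.

Lemma Hgrp1 k : Hgrp d k 1.
Proof. by apply/HgrpE; rewrite expsum1 // dvdz0; split=> //; exact: Ggrp1. Qed.

Lemma HgrpM k g h : Hgrp d k g -> Hgrp d k h -> Hgrp d k (g * h).
Proof.
move=> /HgrpE[Gg eg] /HgrpE[Gh eh]; apply/HgrpE; split; first exact: GgrpM.
by rewrite expsumM // rpredD.
Qed.

Lemma HgrpV k g : Hgrp d k g -> Hgrp d k g^-1.
Proof.
move=> /HgrpE[Gg eg]; apply/HgrpE; split; first exact: GgrpV.
by rewrite expsumV // rpredN.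
Qed.

Lemma rist_section_off k (u v : k.-tuple 'I_d) g : rist u g -> v != u ->
  tsection g v = 1.
Proof.
move=> [_ gu] vu; have off t : g (v ++ t) = v ++ t.
  apply: gu => -[t' /eqP]; rewrite eqseq_cat ?size_tuple // => /andP[/eqP vu' _].
  by move: vu; rewrite -val_eqE /= vu' eqxx.
by apply: tsection_uniq => t; rewrite off -{2}[tval v]cats0 off cats0.
Qed.

(** A generator of the level rigid stabilizer has all but one of its sections
    at level k trivial, and the remaining one is governed by
    [expsum_rist_section]; psi_k is multiplicative on the level stabilizer. *)
Lemma psi_rist_level k g : (0 < k)%N -> rist_level d k g ->
  forall u : k.-tuple 'I_d, Hgrp d k (psi k g u).
Proof.
move=> k0; suff : rist_level d k `<=`
    [set g | stab_level d k g /\ forall u : k.-tuple 'I_d, Hgrp d k (psi k g u)].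
  by move=> sub /sub[].
apply: smallest_sub => [|{}g [u _ Hg]]; last first.
  have gS : rist_level d k g.
    by move=> K [_ KS]; apply: KS; exists u.
  split=> [|v]; first exact: rist_level_sub_stab.
  rewrite /psi; have [->|vu] := eqVneq v u; last first.
    by rewrite (rist_section_off Hg vu); exact: Hgrp1.
  apply/HgrpE; split; first by apply: Ggrp_section; case: Hg.
  by have := expsum_rist_section _ Hg; rewrite size_tuple; apply.
split=> [|g1 g2 [S1 H1] [S2 H2]|g1 [S1 H1]].
- split=> [|u]; first by split=> //; exact: Ggrp1.
  by rewrite /psi tsection1; exact: Hgrp1.
- split=> [|u]; last by rewrite psiM //; exact: HgrpM.
  case: S1 S2 => [G1 f1] [G2 f2]; split=> [|u]; first exact: GgrpM.
  by rewrite tree_autME f1 f2.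
- case: S1 => [G1 f1].
  have f1V (u : k.-tuple 'I_d) : g1^-1 u = u.
    by rewrite tree_autVE -{1}(f1 u) taut_funK.
  split=> [|u]; first by split=> //; exact: GgrpV.
  by rewrite /psi -{1}(f1 u) tsectionV; exact: HgrpV (H1 u).
Qed.

Lemma psi_rist_prod k (h g : k.-tuple 'I_d -> tree_aut d) (s : seq (k.-tuple 'I_d)) :
  (forall u : k.-tuple 'I_d, rist u (g u) /\ tsection (g u) u = h u) -> uniq s ->
  rist_level d k (\prod_(u <- s) g u) /\
  psi k (\prod_(u <- s) g u) = fun u : k.-tuple 'I_d => if u \in s then h u else 1.
Proof.
move=> Hg; elim: s => [|u s IH] /=.
  rewrite big_nil => _; split; first by move=> K [[]].
  by apply: funext => u; rewrite /psi tsection1.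
move=> /andP[us /IH[Hs es]]; have [gu hu] := Hg u; rewrite big_cons.
have gS : rist_level d k (g u) by move=> K [_ KS]; apply: KS; exists u.
split; first by move=> K HK; have [[_ KM _] _] := HK; apply: KM; [exact: gS|exact: Hs].
rewrite psiM ?es; last exact: rist_level_sub_stab.
apply: funext => v; rewrite inE /psi; have [->|vu] := eqVneq v u.
  by rewrite hu (negPf us) mulg1.
by rewrite (rist_section_off gu vu) mul1g.
Qed.
End Rist.

Theorem theorem4p5 (d : nat) (hd3 : (3 <= d)%N) (hodd : odd d)
    (k : nat) (hk : (1 <= k)%N) :
  [set psi k g | g in rist_level d k] =
  [set h : k.-tuple 'I_d -> tree_aut d | forall u, Hgrp d k (h u)].
Proof.
apply/seteqP; split=> [_ [g Hg <-]|h Hh] /=; first exact: psi_rist_level.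
have /choice[g Hg] : forall u : k.-tuple 'I_d,
    exists g, rist u g /\ tsection g u = h u.
  move=> u; have /HgrpE[Gh eh] := Hh u.
  have := @rist_section_exists d hd3 u (h u) hodd Gh.
  by rewrite size_tuple; exact.
have [Hs es] := psi_rist_prod Hg (enum_uniq {: k.-tuple 'I_d}).
exists (\prod_(u <- enum {: k.-tuple 'I_d}) g u)%g => //.
by rewrite es; apply: funext => u; rewrite mem_enum.
Qed.
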